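(* Let $(\Omega,\mathcal F)$ be a measurable space with a filtration $\{\mathcal F_m\}_{m=0}^\infty$, $\mathcal F_0=\{\emptyset,\Omega\}$, and let $M$ be a convex set of equivalent measures on $\mathcal F$. A nonnegative supermartingale $\{f_m,\mathcal F_m\}_{m=0}^\infty$ relative to $M$ is local regular if and only if for every $m\ge1$ there exists an $\mathcal F_m$-measurable random variable $\xi_m^0\in A_0$ such that $$\frac{f_m}{f_{m-1}}\le\xi_m^0,\qquad E^P\{\xi_m^0|\mathcal F_{m-1}\}=1,\quad P\in M,\quad m=1,2,\dots.$$
   Context: Setting. $(\Omega,\mathcal F)$ is a measurable space with filtration $\mathcal F_m\subset\mathcal F_{m+1}\subset\mathcal F$, $m=0,1,2,\dots$, $\mathcal F_0=\{\emptyset,\Omega\}$. $M$ is a convex set of mutually equivalent probability measures on $\mathcal F$; $E^P$ is expectation under $P$. A process $\{\psi_m\}$ is adapted if $\psi_m$ is $\mathcal F_m$-measurable for all $m$. An adapted process $\{f_m\}$ is a supermartingale relative to $M$ if $E^P|f_m|<\infty$ for $m\ge 1$, $P\in M$, and $E^P\{f_m|\mathcal F_k\}\le f_k$ for $0\le k\le m$, $P\in M$. $A_0$ is the set of all nonnegative random variables $\xi$, integrable relative to all $P\in M$, with $E^P\xi=1$ for all $P\in M$. Regular supermartingale. Let $\{f_m,\mathcal F_m\}$ be a supermartingale relative to $M$ for which there are a random variable $\varphi$ and a real $T$ with $|f_m|\le\varphi$ for all $m\ge 0$ and $E^Q\varphi<T<\infty$ for all $Q\in M$ ($T$ not depending on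 $Q$). For $\hat P_1,\dots,\hat P_s\in M$ put $\hat M_s=\{\sum_{i=1}^s\gamma_i\hat P_i:\gamma_i\ge0,\sum_i\gamma_i=1\}$ and let $G_s$ be the set of adapted non-decreasing processes $g=\{g_m\}_{m=0}^\infty$, $g_0=0$, such that $\{f_m+g_m\}$ is a supermartingale relative to all measures in $\hat M_s$. Processes are partially ordered by $g^1\preceq g^2$ iff $g^1_m\le g^2_m$ almost surely for all $m$; a maximal chain is a totally ordered subset maximal under inclusion. The supermartingale is called regular if for every finite family $\hat P_1,\dots,\hat P_s\in M$ satisfying $0<l\le \frac{d\hat P_i}{d\hat P_j}\le L<\infty$, $i,j=1,\dots,s$ (with real $l,L$ depending on the family): (i) there exist $1\le m_0<\infty$ and an $\mathcal F_{m_0-1}$-measurable nonnegative random variable $\varphi_{m_0}^s$ with $\hat P_1(\varphi_{m_0}^s>0)>0$ such that $f_{m_0-1}-E^{\hat P_i}\{f_{m_0}|\mathcal F_{m_0-1}\}\ge\varphi_{m_0}^s$, $i=1,\dots,s$; (ii) for the maximal element $g^s=\{g^s_m\}$ in a certain maximal chain $\tilde G_s\subseteq G_s$, $E^{\hat P_i}\{f_m+g^s_m|\mathcal F_k\}=f_k+g_k^s$ for $0\le k\le m$, $m\ge1$, $i=1,\dots,s$; and moreover (iii) there exists an adapted nonnegative process $\bar g^0=\{\bar g^0_m\}_{m=0}^\infty$, $\bar g^0_0=0$, $E^P\bar g_m^0<\infty$ for $m\ge1$, $P\in M$, not depending on the family $\hat P_1,\dots,\hat P_s$, such that $E^{\hat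 P_i}\{g_m^s-g_{m-1}^s|\mathcal F_{m-1}\}=E^{\hat P_i}\{\bar g^0_m|\mathcal F_{m-1}\}$ for $m\ge1$, $i=1,\dots,s$. Local regular supermartingale. A supermartingale $f$ with $\sup_{P\in M}E^P|f_m|<\infty$ for all $m\ge0$ is local regular if there is an increasing sequence of nonrandom times $\tau_{k_s}=k_s<\infty$, $k_s\to\infty$ as $s\to\infty$, such that for every $s$ the stopped process $\{f_{m\wedge k_s},\mathcal F_m\}_{m=0}^\infty$ is a regular supermartingale relative to $M$.
   Formalization: The formal theorem adds that f is not a martingale relative to all P in M: a martingale such as f=1 satisfies the ratio criterion (with ξ=1) but is never local regular, since clause (i) of regularity demands a genuine one-step decrease. *)

(* Defs.v *)
From HB Require Import structures.
From mathcomp Require Import all_boot all_order all_algebra.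
From mathcomp Require Import all_classical all_reals all_analysis.
From mathcomp Require Import measurable_realfun.

Set Implicit Arguments.
Unset Strict Implicit.
Unset Printing Implicit Defensive.
Import Order.TTheory GRing.Theory Num.Theory.
Import numFieldNormedType.Exports.

Local Open Scope classical_set_scope.
Local Open Scope ring_scope.
Local Open Scope charge_scope.

Section definitions.
Context {d : measure_display} {T : measurableType d} {R : realType}.
Implicit Types (P Q : probability T R) (M : set (probability T R)).
Implicit Types (G : set (set T)) (F : nat -> set (set T)).
Implicit Types (X Y : T -> R) (f g h : nat -> T -> R).

Definition filtration F : Prop :=
  [/\ forall m, sigma_algebra setT (F m),
      forall m, F m `<=` measurable &
      forall m, F m `<=` F m.+1].

Definition measurable_wrt G X : Prop :=
  measurable_fun [set: g_sigma_algebraType G] (X : g_sigma_algebraType G -> R).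

Definition adapted F f : Prop := forall m, measurable_wrt (F m) (f m).

Definition is_cond_exp P G X Y : Prop :=
  [/\ measurable_wrt G Y,
      P.-integrable setT (EFin \o Y) &
      forall A, G A ->
        (\int[P]_(x in A) (Y x)%:E = \int[P]_(x in A) (X x)%:E)%E].

(* A chosen version of E^P(X | G); it is 0 when there is no version, which does
   not happen for integrable X (see cond_expP below).  Since versions agree only
   up to null sets, statements about it are meaningful only almost surely. *)
Definition cond_exp P G X : T -> R := xget (cst 0) (is_cond_exp P G X).

(* Relations between random variables hold almost surely.  The members of M are
   mutually equivalent, so that quantifying over all of them is the same as
   choosing one. *)
Definition as_le M X Y : Prop :=
  forall P, M P -> {ae P, forall x, X x <= Y x}.

Definition as_eq M X Y : Prop :=
  forall P, M P -> {ae P, forall x, X x = Y x}.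

Definition mutually_equivalent M : Prop :=
  forall P Q, M P -> M Q -> P `<< Q.

(* A measure is determined by its values on the sigma-algebra of T, whereas
   elements of [probability T R] also take (irrelevant) values on nonmeasurable
   sets; hence convex combinations are compared on measurable sets only. *)
Definition convex_measures M : Prop :=
  forall P Q (t : R), M P -> M Q -> 0 <= t <= 1 ->
    exists2 S, M S & forall A, measurable A ->
      (S A = t%:E * P A + (1 - t)%:E * Q A)%E.

Definition hull n (Ph : 'I_n -> probability T R) : set (probability T R) :=
  [set Q | exists gamma : 'I_n -> R,
    [/\ forall i, 0 <= gamma i,
        \sum_(i < n) gamma i = 1 &
        forall A, measurable A ->
          (Q A = \sum_(i < n) (gamma i)%:E * Ph i A)%E]].

Definition supermartingale M F f : Prop :=
  [/\ adapted F f,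
      forall m P, (1 <= m)%N -> M P -> P.-integrable setT (EFin \o f m) &
      forall k m P, (k <= m)%N -> M P ->
        {ae P, forall x, cond_exp P (F k) (f m) x <= f k x}].

Definition martingale M F f : Prop :=
  [/\ adapted F f,
      forall m P, (1 <= m)%N -> M P -> P.-integrable setT (EFin \o f m) &
      forall k m P, (k <= m)%N -> M P ->
        {ae P, forall x, cond_exp P (F k) (f m) x = f k x}].

Definition A0 M : set (T -> R) :=
  [set xi | [/\ as_le M (cst 0) xi,
                forall P, M P -> P.-integrable setT (EFin \o xi) &
                forall P, M P -> ('E_P[xi] = 1)%E]].

(* The set G_s; Mhat is meant to be the hull of the given finite family. *)
Definition increments Mhat F f : set (nat -> T -> R) :=
  [set g | [/\ adapted F g,
               forall m, as_le Mhat (g m) (g m.+1),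
               g 0%N = cst 0 &
               supermartingale Mhat F (fun m x => f m x + g m x)]].

Definition process_le M g h : Prop := forall m, as_le M (g m) (h m).

Definition maximal_chain (U : Type) (le : U -> U -> Prop) (E C : set U) : Prop :=
  [/\ C `<=` E,
      total_on C le &
      forall D, D `<=` E -> total_on D le -> C `<=` D -> D = C].

(* In a totally ordered set a maximal element is a greatest one. *)
Definition maximum_of (U : Type) (le : U -> U -> Prop) (C : set U) (g : U) : Prop :=
  C g /\ forall u, C u -> le u g.

Definition density_bounded n (Ph : 'I_n -> probability T R) (l L : R) : Prop :=
  forall i j, {ae Ph j, forall x,
    (l%:E <= ('d (charge_of_finite_measure (Ph i)) '/d (Ph j)) x <= L%:E)%E}.

Definition regular M F f : Prop :=
  [/\ supermartingale M F f,
      exists (phi : T -> R) (t : R),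
        [/\ measurable_fun setT phi,
            forall m, as_le M (fun x => `|f m x|) phi &
            forall Q, M Q -> ('E_Q[phi] < t%:E)%E] &
      exists gbar : nat -> T -> R,
        [/\ adapted F gbar,
            forall m, as_le M (cst 0) (gbar m),
            gbar 0%N = cst 0,
            forall m P, (1 <= m)%N -> M P -> ('E_P[gbar m] < +oo)%E &
            forall (s : nat) (Ph : 'I_s.+1 -> probability T R) (l L : R),
              (forall i, M (Ph i)) -> 0 < l -> density_bounded Ph l L ->
              (exists (m0 : nat) (phi : T -> R),
                 [/\ (1 <= m0)%N,
                     measurable_wrt (F m0.-1) phi,
                     as_le M (cst 0) phi,
                     (0 < Ph ord0 [set x | (0 < phi x)%R])%E &
                     forall i, as_le M phi (fun x =>
                       f m0.-1 x - cond_exp (Ph i) (F m0.-1) (f m0) x)]) /\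
              (exists (C : set (nat -> T -> R)) (g : nat -> T -> R),
                 [/\ maximal_chain (process_le (hull Ph))
                       (increments (hull Ph) F f) C,
                     maximum_of (process_le (hull Ph)) C g,
                     forall k m i, (k <= m)%N -> (1 <= m)%N ->
                       as_eq M (cond_exp (Ph i) (F k) (fun x => f m x + g m x))
                               (fun x => f k x + g k x) &
                     forall m i, (1 <= m)%N ->
                       as_eq M
                         (cond_exp (Ph i) (F m.-1)
                            (fun x => g m x - g m.-1 x))
                         (cond_exp (Ph i) (F m.-1) (gbar m))])]].

Definition local_regular M F f : Prop :=
  [/\ supermartingale M F f,
      forall m, (ereal_sup [set 'E_P[fun x => (`|f m x|)%R] | P in M] < +oo)%E &
      exists k : nat -> nat,
        [/\ increasing_seq k,
            k n @[n --> \oo] --> \oo &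
            forall s, regular M F (fun m => f (minn m (k s)))]].

End definitions.

Section conditional_expectation.
Context {d : measure_display} {T : measurableType d} {R : realType}.
Variables (P : probability T R) (G : set (set T)).
Hypotheses (sG : sigma_algebra setT G) (GT : G `<=` measurable).

Let mGE : (measurable : set (set (g_sigma_algebraType G))) = G.
Proof. exact: sigma_algebra_id. Qed.

Let mGT (A : set T) :
  measurable (A : set (g_sigma_algebraType G)) -> d.-measurable A.
Proof. by rewrite mGE; exact: GT. Qed.

Lemma measurable_wrt_preimage (X : T -> R) (B : set R) :
  measurable_wrt G X -> measurable B -> G (X @^-1` B).
Proof. by move=> mX mB; rewrite -mGE -[_ @^-1` _]setTI; exact: mX. Qed.

Lemma measurable_wrt_measurable (X : T -> R) :
  measurable_wrt G X -> measurable_fun setT X.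
Proof.
by move=> mX _ B mB; rewrite setTI; apply/GT/measurable_wrt_preimage.
Qed.

Let mid : measurable_fun [set: T] (id : T -> g_sigma_algebraType G).
Proof. by move=> _ B mB; rewrite setTI; apply: GT; rewrite -mGE. Qed.

Let idG : {mfun T >-> g_sigma_algebraType G} :=
  MeasurableFun.Pack (MeasurableFun.Class (isMeasurableFun.Build _ _ _ _ _ mid)).

Lemma cond_expP (X : T -> R) :
  P.-integrable setT (EFin \o X) -> is_cond_exp P G X (cond_exp P G X).
Proof.
move=> iX; apply: xgetPex.
pose mu : probability (g_sigma_algebraType G) R := distribution P idG.
pose nu0 : {charge set (g_sigma_algebraType G) -> \bar R} :=
  pushforward (induced_charge iX) idG.
pose nu := nu0 mid.
have /integrableP[mX _] := iX.
have numu : nu `<< mu.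
  apply/null_content_dominatesP => A mA PA0.
  have {}mA : d.-measurable A := @mGT A mA.
  rewrite /nu /nu0 /pushforward /induced_charge /=.
  apply: (null_set_integral mA) => //.
  by apply: (measurable_funS measurableT).
have ih := Radon_Nikodym_integrable numu.
have /integrableP[mh hoo] := ih.
have hfin x : 'd nu '/d mu x \is a fin_num by exact: Radon_Nikodym_fin_num.
pose Y x := fine ('d nu '/d mu x).
have YE : EFin \o Y = 'd nu '/d mu by apply/funext => x /=; rewrite fineK.
have mabs : measurable_fun setT (abse : \bar R -> \bar R) by [].
have mfin : measurable_fun setT (fine : \bar R -> R) by [].
have mah := measurableT_comp mabs mh.
have iY : P.-integrable setT (EFin \o Y).
  rewrite YE; apply/integrableP; split.
    by move=> _ B mB; apply: mGT; exact: mh.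
  by move: hoo; rewrite (@ge0_integral_distribution _ _ _ _ _ P idG).
exists Y; split => //.
- exact: (measurableT_comp mfin mh).
- move=> A GA.
  have mA : measurable (A : set (g_sigma_algebraType G)) by rewrite mGE.
  have := Radon_Nikodym_integral numu mA.
  rewrite (@integral_pushforward _ _ _ _ _ _ mid P A _ mh) //; last first.
    apply: (integrableS measurableT) => //; first exact: mGT.
    by rewrite -YE.
  by move=> H; rewrite [RHS]H; apply: eq_integral => x _ /=; rewrite fineK.
Qed.
End conditional_expectation.

Section local_regularity.
Context {d : measure_display} {T : measurableType d} {R : realType}.

Lemma is_cond_exp_le (P : probability T R) (G : set (set T)) (X Y Z : T -> R) :
  sigma_algebra setT G -> G `<=` measurable ->
  is_cond_exp P G X Y -> is_cond_exp P G X Z ->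
  {ae P, forall x, Y x <= Z x}.
Proof.
move=> sG GT [mY iY YX] [mZ iZ ZX].
pose D := (fun x => Y x - Z x) @^-1` `]0, +oo[%classic.
have GD : G D.
  by apply: measurable_wrt_preimage => //; exact: measurable_funB.
have mD : measurable D by exact: GT.
have iYD : P.-integrable D (EFin \o Y) by apply: integrableS iY.
have iZD : P.-integrable D (EFin \o Z) by apply: integrableS iZ.
have I0 : (\int[P]_(x in D) ((EFin \o Y) x - (EFin \o Z) x) = 0)%E.
  rewrite integralB//= YX// -ZX// subee//.
  exact: integrable_fin_num.
have iB := integrableB mD iYD iZD.
have mB : measurable_fun D (fun x => (EFin \o Y) x - (EFin \o Z) x)%E.
  by case/integrableP : iB.
have : (\int[P]_(x in D) `|(EFin \o Y) x - (EFin \o Z) x| = 0)%E.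
  rewrite -[RHS]I0; apply: eq_integral => x; rewrite inE /D /= in_itv /= andbT => h.
  by rewrite gtr0_norm.
move/(ae_eq_integral_abs P mD mB); apply: filterS => x /= h.
rewrite leNgt; apply/negP => ZY.
have /h : D x by rewrite /D /= in_itv /= andbT subr_gt0.
by case=> /eqP; rewrite subr_eq0 => /eqP e; move: ZY; rewrite e ltxx.
Qed.

Lemma density_self (P : probability T R) n :
  density_bounded (fun _ : 'I_n => P) 1 1.
Proof.
move=> _ _.
have PP : charge_of_finite_measure P `<< P by [].
have : ae_eq P setT (cst 1%E) ('d (charge_of_finite_measure P) '/d P).
  apply: integral_ae_eq => //.
  - exact: (finite_measure_integrable_cst P 1).
  - move=> E _ mE; rewrite -Radon_Nikodym_integral// integral_cst// mul1e.
    by [].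
apply: filterS => x /(_ I) <- /=.
by rewrite lexx.
Qed.

(* Condition (exists m0 phi, ...) of [regular] asks for a genuine one-step
   decrease, already for one-element families, whence no martingale is local
   regular.  A martingale such as f = 1 may however satisfy the ratio criterion
   (with xi = 1), so the equivalence with local regularity has to be stated for
   supermartingales that are not martingales. *)
Lemma martingale_not_local_regular M F (f : nat -> T -> R) :
  filtration F -> M !=set0 -> martingale M F f -> ~ local_regular M F f.
Proof.
move=> [sF FT FF] [P MP] [af intf ce] [_ _ [k [ik _ /(_ 1%N)]]].
have k1 : (1 <= k 1)%N.
  have : (k 0%N < k 1%N)%O by rewrite (leW_mono ik).
  by rewrite ltEnat /=; exact: leq_ltn_trans.
have FS i j : (i <= j)%N -> F i `<=` F j.
  elim: j => [|j IH]; first by rewrite leqn0 => /eqP ->.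
  by rewrite leq_eqVlt => /orP[/eqP -> //|]; rewrite ltnS => /IH h A /h /FF.
case=> _ _ [gb [_ _ _ _ /(_ 0%N (fun=> P) 1 1)]].
case=> //; first exact: density_self.
move=> [m0 [phi [m01 mphi _ phi0 /(_ ord0 P MP) phile]]] _.
suff fC : {ae P, forall x, f (minn m0.-1 (k 1%N)) x <=
    cond_exp P (F m0.-1) (f (minn m0 (k 1%N))) x}.
  move: phi0; apply/negP; rewrite -leNgt.
  have -> : P [set x | 0 < phi x] = 0%E; last by [].
  have mA : measurable [set x | 0 < phi x].
    rewrite (_ : mkset _ = phi @^-1` `]0, +oo[%classic); last first.
      by apply/seteqP; split => x /=; rewrite in_itv/= andbT.
    by apply: (FT m0.-1); exact: measurable_wrt_preimage.
  apply/(negligibleP _ mA).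
  rewrite (_ : mkset _ = ~` [set x | phi x <= 0]); last first.
    apply/seteqP; split => x /=; first by move=> h; rewrite leNgt h.
    by move=> h; rewrite ltNge; apply/negP.
  suff : {ae P, forall x, phi x <= 0} by [].
  move: phile fC; apply: filterS2 => x /= h1 h2.
  by rewrite (le_trans h1)// subr_le0.
have [mk|km] := leqP m0 (k 1%N).
  rewrite !(minn_idPl _) //; last by rewrite (leq_trans (leq_pred _)).
  by have := ce m0.-1 m0 P (leq_pred _) MP; apply: filterS => x ->.
have km' : (k 1%N <= m0.-1)%N by rewrite -ltnS prednK.
rewrite (minn_idPr km').
apply: (@is_cond_exp_le P (F m0.-1) (f (k 1%N)) _ _ (sF _) (FT _)); last first.
  by apply: cond_expP => //; exact: intf.
split => //; last exact: intf.
move=> mT B mB; have := @measurable_wrt_preimage _ T R _ (sF (k 1%N)) _ _ (af (k 1%N)) mB.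
move=> /(FS _ _ km'); rewrite setTI => h.
by rewrite /measurable /= sigma_algebra_id.
Qed.

End local_regularity.

(* Main.v *)
(* If f_m <= f_(m-1) xi_m with E^P(xi_m | F_(m-1)) = 1 for all P in M, the
   losses f_(m-1) xi_m - f_m are nonnegative and do not depend on P, and adding
   their partial sums to f turns it into a martingale relative to every P at
   once; this compensator is maximal because it keeps the expectation equal to
   f_0.  As f is not a martingale, some loss m0 is not a.s. zero, and because the
   measures are equivalent its conditional expectations under any finite family
   are positive on a common set of positive probability; so f stopped at any
   time K >= m0 is regular.  Conversely, regularity of the process stopped at
   K >= m, applied to one-element families, gives gbar_m >= 0 with
   E^P(f_m + gbar_m | F_(m-1)) = f_(m-1) for all P, and
   xi_m = (f_m + gbar_m) / f_(m-1) (and 1 where f_(m-1) = 0) is as required. *)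
Require Import Defs.
From mathcomp Require Import all_boot all_order all_algebra.
From mathcomp Require Import all_classical all_reals all_analysis.
From mathcomp Require Import measurable_realfun.

Set Implicit Arguments.
Unset Strict Implicit.
Unset Printing Implicit Defensive.
Import Order.TTheory GRing.Theory Num.Theory.
Import numFieldNormedType.Exports.
Import HBNNSimple.

Local Open Scope classical_set_scope.
Local Open Scope ring_scope.

(** * Integrals and sub-sigma-algebras *)

Section sub_sigma_algebra.
Context {d : measure_display} {T : measurableType d} {R : realType}.
Implicit Types (P Q : probability T R) (G H : set (set T)) (X Y Z W : T -> R).

Lemma measurable_wrt_sub G H X : sigma_algebra setT G -> sigma_algebra setT H ->
  G `<=` H -> measurable_wrt G X -> measurable_wrt H X.
Proof.
move=> sG sH GH mX _ B mB; rewrite setTI.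
have := GH _ (measurable_wrt_preimage sG mX mB).
by rewrite /measurable /= sigma_algebra_id.
Qed.

Lemma sigma_algebra_setT G : sigma_algebra setT G -> G setT.
Proof. by case=> G0 GC _; rewrite -(setD0 setT); exact: GC. Qed.

Lemma sigma_algebra_setI G A B : sigma_algebra setT G ->
  G A -> G B -> G (A `&` B).
Proof.
move=> sG; have <- : (measurable : set (set (g_sigma_algebraType G))) = G.
  exact: sigma_algebra_id.
exact: measurableI.
Qed.

(** The preimage of the singleton of a value [X x0] contains [x0], so it must be the whole space.
    This makes the initial value of an adapted process a constant. *)
Lemma measurable_wrt_trivial X :
  measurable_wrt [set set0; setT] X -> exists c, X = cst c.
Proof.
move=> mX.
have sG : sigma_algebra [set: T] [set set0; setT].
  split=> [|A|A hA]; first by left.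
  - by case=> ->; rewrite ?setD0 ?setDT; [right|left].
  - have [[n An]|nA] := pselect (exists n, A n = setT).
      by right; apply/seteqP; split => // x _; exists n => //; rewrite An.
    left; apply/seteqP; split => // x [n _].
    by case: (hA n) => [->//|An]; case: nA; exists n.
have [[x0 _]|T0] := pselect (exists x : T, True); last first.
  by exists 0; apply/funext => x; case: T0; exists x.
exists (X x0); apply/funext => x /=.
have [] := measurable_wrt_preimage sG mX (measurable_set1 (X x0)).
  by move/seteqP => [/(_ x0)]; case.
by move/seteqP => [_ /(_ x I)].
Qed.

Section integral_mul.
Context (P : probability T R) (G : set (set T)).
Hypotheses (sG : sigma_algebra setT G) (GT : G `<=` measurable).

(** The set A is split along the level sets of the simple function [h], which belong to G. *)
Let integral_mul_nnsfun (h : {nnsfun g_sigma_algebraType G >-> R}) Z A : G A ->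
  measurable_fun setT Z -> (forall x, 0 <= Z x) ->
  (\int[P]_(x in A) (h x * Z x)%:E =
   \sum_(y \in range h) y%:E * \int[P]_(x in A `&` h @^-1` [set y]) (Z x)%:E)%E.
Proof.
move=> GA mZ Z0.
have mA := GT GA.
have mh y : measurable (h @^-1` [set y] : set T).
  apply: GT; apply: measurable_wrt_preimage => //; exact: measurable_funPT.
have mhZ y : measurable_fun A
    (fun x => (y%:E * (\1_(h @^-1` [set y]) x)%:E * (Z x)%:E)%E).
  apply: emeasurable_funM; last first.
    by apply/measurable_EFinP; exact: measurable_funTS.
  by apply/measurable_EFinP/measurable_funM => //; exact: measurable_indic.
transitivity (\int[P]_(x in A)
   (\sum_(y \in range h) (y%:E * (\1_(h @^-1` [set y]) x)%:E * (Z x)%:E)))%E.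
  apply: eq_integral => x xA.
  rewrite EFinM {1}(fimfunE h x) -fsumEFin// ge0_mule_fsuml// => y.
  exact: nnfun_muleindic_ge0.
rewrite ge0_integral_fsum//; last first.
  move=> y x _; apply: mule_ge0; last by rewrite lee_fin.
  exact: nnfun_muleindic_ge0.
apply: eq_fsbigr => y /[!inE] -[t _ <-].
rewrite integral_mkcondr epatch_indic -ge0_integralZl_EFin//; first last.
- apply: emeasurable_funM; apply/measurable_EFinP.
    exact: measurable_funTS.
  exact: measurable_indic.
- by move=> x _; rewrite mule_ge0 ?lee_fin.
by apply: eq_integral => x _; rewrite -muleA [in X in (_ * X)%E]muleC.
Qed.

(** Pulling out a known factor: Y is an increasing limit of G-simple functions, for which the claim
    reduces to the equality of the integrals of W and Z on sets of G. Monotone convergence does the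
    rest, with values in the extended reals. *)
Lemma integral_mul_wrt Y Z W A : measurable_wrt G Y ->
  measurable_fun setT Z -> measurable_fun setT W ->
  (forall x, 0 <= Y x) -> (forall x, 0 <= Z x) -> (forall x, 0 <= W x) ->
  (forall B, G B ->
    (\int[P]_(x in B) (W x)%:E = \int[P]_(x in B) (Z x)%:E)%E) ->
  G A -> (\int[P]_(x in A) (Y x * W x)%:E = \int[P]_(x in A) (Y x * Z x)%:E)%E.
Proof.
move=> mY mZ mW Y0 Z0 W0 WZ GA.
have mA := GT GA.
have mEY : measurable_fun [set: g_sigma_algebraType G] (EFin \o Y).
  exact/measurable_EFinP.
pose h := nnsfun_approx measurableT mEY.
have mh n : measurable_fun [set: T] (h n).
  by apply: (measurable_wrt_measurable sG GT); exact: measurable_funPT.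
have lim_int X : measurable_fun setT X -> (forall x, 0 <= X x) ->
    (\int[P]_(x in A) (Y x * X x)%:E =
     lim (\int[P]_(x in A) (h n x * X x)%:E @[n --> \oo]))%E.
  move=> mX X0; rewrite -monotone_convergence//.
  - apply: eq_integral => x _; apply/esym/cvg_lim => //.
    under eq_fun do rewrite EFinM.
    rewrite EFinM; apply: cvgeZr => //.
    by apply: (cvg_nnsfun_approx measurableT mEY) => // y _; rewrite lee_fin.
  - move=> n; apply/measurable_EFinP/measurable_funTS.
    exact: measurable_funM.
  - by move=> n x _; rewrite lee_fin mulr_ge0.
  - move=> x _ m n mn; rewrite lee_fin ler_wpM2r//.
    by have /lefP := nd_nnsfun_approx measurableT mEY mn; exact.
rewrite !lim_int//; congr (lim (_ @ \oo)); apply/funext => n.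
rewrite !integral_mul_nnsfun//; apply: eq_fsbigr => y _; congr (_ * _)%E.
apply: WZ; apply: sigma_algebra_setI => //.
by apply: measurable_wrt_preimage => //; exact: measurable_funPT.
Qed.

End integral_mul.
End sub_sigma_algebra.

(** * Real integrals under almost sure relations *)

Section almost_everywhere.
Context {d : measure_display} {T : measurableType d} {R : realType}.
Implicit Types (P Q : probability T R) (M : set (probability T R)).
Implicit Types (X Y Z W : T -> R).

Lemma integrable_measurable P X :
  P.-integrable setT (EFin \o X) -> measurable_fun setT X.
Proof. by case/integrableP => /measurable_EFinP. Qed.

Lemma measurable_abse_EFin X : measurable_fun setT X ->
  measurable_fun setT (abse \o (EFin \o X)).
Proof.
move=> mX; have mabs : measurable_fun setT (abse : \bar R -> \bar R) by [].
have mEX : measurable_fun setT (EFin \o X) by exact/measurable_EFinP.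
exact: (measurableT_comp mabs mEX).
Qed.

Lemma ae_integrable P X Y : measurable_fun setT Y ->
  {ae P, forall x, X x = Y x} ->
  P.-integrable setT (EFin \o X) -> P.-integrable setT (EFin \o Y).
Proof.
move=> mY XY iX; have mX := integrable_measurable iX.
case/integrableP : iX => _ Xoo; apply/integrableP.
split; first exact/measurable_EFinP.
have XYE : ae_eq P setT (abse \o (EFin \o X)) (abse \o (EFin \o Y)).
  by apply: filterS XY => x /= -> _.
rewrite -(ge0_ae_eq_integral _ (measurable_abse_EFin mX)
  (measurable_abse_EFin mY) _ _ XYE)// => x _.
  exact: abse_ge0.
exact: abse_ge0.
Qed.

Lemma ae_Rintegral P X Y A : measurable A ->
  measurable_fun setT X -> measurable_fun setT Y ->
  {ae P, forall x, X x = Y x} ->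
  \int[P]_(x in A) X x = \int[P]_(x in A) Y x.
Proof.
move=> mA mX mY XY.
have XYE : ae_eq P A (EFin \o X) (EFin \o Y).
  by apply: filterS XY => x /= -> _.
congr fine; apply: (ae_eq_integral _ _ _ _ _ XYE) => //.
- by apply: measurable_funTS; exact/measurable_EFinP.
- by apply: measurable_funTS; exact/measurable_EFinP.
Qed.

Lemma integrableTS P X A : measurable A ->
  P.-integrable setT (EFin \o X) -> P.-integrable A (EFin \o X).
Proof. by move=> mA; exact: integrableS. Qed.

Lemma Rintegral_EFin P X A : measurable A ->
  P.-integrable setT (EFin \o X) ->
  (\int[P]_(x in A) (X x)%:E = (\int[P]_(x in A) X x)%:E)%E.
Proof.
move=> mA iX; rewrite /Rintegral fineK//.
by apply: integrable_fin_num => //; exact: (integrableTS mA iX).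
Qed.

Lemma integrableDr P X Y : P.-integrable setT (EFin \o X) ->
  P.-integrable setT (EFin \o Y) ->
  P.-integrable setT (EFin \o (fun x => X x + Y x)).
Proof. by move=> iX iY; exact: (integrableD measurableT iX iY). Qed.

Lemma integrableBr P X Y : P.-integrable setT (EFin \o X) ->
  P.-integrable setT (EFin \o Y) ->
  P.-integrable setT (EFin \o (fun x => X x - Y x)).
Proof. by move=> iX iY; exact: (integrableB measurableT iX iY). Qed.

(** Replacing Y by max(X, Y), which equals Y almost surely, turns the inequality into a pointwise
    one. *)
Lemma ae_le_Rintegral P X Y A : measurable A ->
  P.-integrable setT (EFin \o X) -> P.-integrable setT (EFin \o Y) ->
  {ae P, forall x, X x <= Y x} ->
  \int[P]_(x in A) X x <= \int[P]_(x in A) Y x.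
Proof.
move=> mA iX iY XY.
have mX := integrable_measurable iX; have mY := integrable_measurable iY.
have mM : measurable_fun setT (fun x => Num.max (X x) (Y x)).
  exact: measurable_maxr.
have XYM : {ae P, forall x, Y x = Num.max (X x) (Y x)}.
  by move: XY; apply: filterS => x /max_idPr ->.
rewrite (ae_Rintegral mA mY mM XYM); apply: le_Rintegral => //.
- exact: integrableTS.
- by apply: integrableTS => //; exact: ae_integrable XYM iY.
- by move=> x _ /=; rewrite le_max lexx.
Qed.

(** On A the variable agrees a.s. with its absolute value, whose integral is then both nonnegative
    and at most 0. This is the source of all the strictness arguments below. *)
Lemma ae_eq0_Rintegral P X A : measurable A ->
  P.-integrable setT (EFin \o X) -> {ae P, forall x, A x -> 0 <= X x} ->
  \int[P]_(x in A) X x <= 0 -> {ae P, forall x, A x -> X x = 0}.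
Proof.
move=> mA iX X0 intX.
have mX := integrable_measurable iX.
have mXA : measurable_fun A (EFin \o X).
  by apply: measurable_funTS; exact/measurable_EFinP.
suff : (\int[P]_(x in A) `|(EFin \o X) x| = 0)%E.
  move/(ae_eq_integral_abs P mA mXA); apply: filterS => x /= h /h.
  by case.
have -> : (\int[P]_(x in A) `|(EFin \o X) x| = \int[P]_(x in A) (X x)%:E)%E.
  apply: ae_eq_integral => //.
    exact: measurableT_comp.
  by move: X0; apply: filterS => x /= h /h X0; rewrite ger0_norm.
apply/eqP; rewrite eq_le; apply/andP; split.
  by rewrite Rintegral_EFin// lee_fin.
have -> : (\int[P]_(x in A) (X x)%:E = \int[P]_(x in A) `|(EFin \o X) x|)%E.
  apply: ae_eq_integral => //.
    exact: measurableT_comp.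
  by move: X0; apply: filterS => x /= h /h X0; rewrite ger0_norm.
exact: integral_ge0.
Qed.

Lemma ae_equiv M P Q (phi : T -> Prop) : mutually_equivalent M ->
  M P -> M Q -> {ae P, forall x, phi x} -> {ae Q, forall x, phi x}.
Proof.
move=> Meq MP MQ [A [mA PA0 sA]]; exists A; split => //.
by have /null_content_dominatesP := Meq _ _ MQ MP; exact.
Qed.

End almost_everywhere.

(** * Conditional expectations *)

Section conditional_expectations.
Context {d : measure_display} {T : measurableType d} {R : realType}.
Implicit Types (P Q : probability T R) (G : set (set T)) (X Y Z W : T -> R).

Section one_sigma_algebra.
Context (P : probability T R) (G : set (set T)).
Hypotheses (sG : sigma_algebra setT G) (GT : G `<=` measurable).

(** Once a version exists, [xget] returns one, and any two versions dominate each other almost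
    surely. *)
Lemma cond_exp_ae X Y : is_cond_exp P G X Y ->
  {ae P, forall x, cond_exp P G X x = Y x}.
Proof.
move=> XY; have XC : is_cond_exp P G X (cond_exp P G X).
  by apply: xgetPex; exists Y.
apply: (filterS2 _ _ (is_cond_exp_le sG GT XY XC) (is_cond_exp_le sG GT XC XY)).
by move=> x h1 h2; apply/eqP; rewrite eq_le h1 h2.
Qed.

Lemma is_cond_exp_Rintegral X Y A : P.-integrable setT (EFin \o X) ->
  is_cond_exp P G X Y -> G A ->
  \int[P]_(x in A) Y x = \int[P]_(x in A) X x.
Proof. by move=> iX [_ _ YX] /YX h; rewrite /Rintegral h. Qed.

Lemma Rintegral_is_cond_exp X Y : measurable_wrt G Y ->
  P.-integrable setT (EFin \o X) -> P.-integrable setT (EFin \o Y) ->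
  (forall A, G A -> \int[P]_(x in A) Y x = \int[P]_(x in A) X x) ->
  is_cond_exp P G X Y.
Proof.
move=> mY iX iY YX; split => // A GA.
by rewrite !Rintegral_EFin ?YX//; exact: GT.
Qed.

(** On A = {Y <= 0}, a set of G, the integral of -Y is minus that of X, hence at most 0; since -Y >=
    0 there, Y vanishes a.s. on A. *)
Lemma is_cond_exp_ge0 X Y : P.-integrable setT (EFin \o X) ->
  is_cond_exp P G X Y -> {ae P, forall x, 0 <= X x} ->
  {ae P, forall x, 0 <= Y x}.
Proof.
move=> iX XY X0; have [mY iY _] := XY.
pose A := Y @^-1` `]-oo, 0].
have GA : G A by exact: measurable_wrt_preimage.
have mA := GT GA.
have : {ae P, forall x, A x -> - Y x = 0}.
  have iN : P.-integrable setT (EFin \o (fun x => - Y x)).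
    exact: (integrableN iY).
  apply: ae_eq0_Rintegral => //.
    by apply: aeW => x; rewrite /A/= in_itv/= oppr_ge0.
  under eq_Rintegral do rewrite -mulN1r.
  rewrite RintegralZl//; last exact: integrableTS.
  rewrite mulN1r oppr_le0 (is_cond_exp_Rintegral iX XY GA).
  have <- : \int[P]_(x in A) (cst 0 x) = 0 by rewrite Rintegral_cst// mul0r.
  apply: ae_le_Rintegral => //.
  exact: (finite_measure_integrable_cst P 0).
apply: filterS => x h; rewrite leNgt; apply/negP => Y0.
have /h/eqP : A x by rewrite /A/= in_itv/= ltW.
by rewrite oppr_eq0 lt_eqF.
Qed.

(* The positivity set of a conditional expectation carries the variable, hence
   does not depend on the measure within an equivalence class. *)
Lemma is_cond_exp_le0 X Y : P.-integrable setT (EFin \o X) ->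
  is_cond_exp P G X Y -> {ae P, forall x, 0 <= X x} ->
  {ae P, forall x, Y x <= 0 -> X x = 0}.
Proof.
move=> iX XY X0; have [mY iY _] := XY.
pose A := Y @^-1` `]-oo, 0].
have GA : G A by exact: measurable_wrt_preimage.
have mA := GT GA.
have : {ae P, forall x, A x -> X x = 0}.
  apply: ae_eq0_Rintegral => //; first by move: X0; apply: filterS.
  rewrite -(is_cond_exp_Rintegral iX XY GA).
  have <- : \int[P]_(x in A) (cst 0 x) = 0 by rewrite Rintegral_cst// mul0r.
  apply: le_Rintegral => //.
  - exact: integrableTS.
  - exact: (finite_measure_integrable_cst P 0).
by apply: filterS => x h Y0; apply: h; rewrite /A/= in_itv.
Qed.

(** Integrability passes from Y W to Y Z: this yields the integrability of [xi] in one direction of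
    the theorem and of f_(m-1) xi_m in the other. Z and W are only a.s. nonnegative, so both are
    replaced by their positive parts before [integral_mul_wrt] is applied. *)
Lemma is_cond_exp_mul Y Z W : measurable_wrt G Y -> (forall x, 0 <= Y x) ->
  P.-integrable setT (EFin \o Z) -> is_cond_exp P G Z W ->
  {ae P, forall x, 0 <= Z x} ->
  P.-integrable setT (EFin \o (fun x => Y x * W x)) ->
  P.-integrable setT (EFin \o (fun x => Y x * Z x)) /\
  is_cond_exp P G (fun x => Y x * Z x) (fun x => Y x * W x).
Proof.
move=> mY Y0 iZ ZW Z0 iYW.
have W0 := is_cond_exp_ge0 iZ ZW Z0.
have [mW iW _] := ZW.
have mYT := measurable_wrt_measurable sG GT mY.
have mWT := measurable_wrt_measurable sG GT mW.
have mZ := integrable_measurable iZ.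
pose pos X x : R := Num.max 0 (X x).
have pos0 X x : 0 <= pos X x by rewrite le_max lexx.
have mpos X : measurable_fun setT X -> measurable_fun setT (pos X).
  by move=> mX; exact: measurable_maxr.
have posE X : {ae P, forall x, 0 <= X x} -> {ae P, forall x, X x = pos X x}.
  by apply: filterS => x /max_idPr.
have iposW := ae_integrable (mpos _ mWT) (posE _ W0) iW.
have iposZ := ae_integrable (mpos _ mZ) (posE _ Z0) iZ.
have mulE X : {ae P, forall x, 0 <= X x} ->
    {ae P, forall x, Y x * X x = Y x * pos X x}.
  by move/posE; apply: filterS => x <-.
have mM X : measurable_fun setT X -> measurable_fun setT (fun x => Y x * X x).
  by move=> mX; exact: measurable_funM.
have iYpW := ae_integrable (mM _ (mpos _ mWT)) (mulE _ W0) iYW.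
have intE A : G A -> (\int[P]_(x in A) (Y x * pos W x)%:E =
                      \int[P]_(x in A) (Y x * pos Z x)%:E)%E.
  move=> GA; apply: (@integral_mul_wrt _ _ _ P G) => //; try exact: mpos.
  move=> B GB; have mB := GT GB.
  rewrite !Rintegral_EFin//; congr EFin.
  rewrite -(ae_Rintegral mB mWT (mpos _ mWT) (posE _ W0)).
  rewrite -(ae_Rintegral mB mZ (mpos _ mZ) (posE _ Z0)).
  exact: is_cond_exp_Rintegral.
(* The integral of Y Z over the whole space, itself a set of G, equals the finite integral of Y
   W. *)
have iYZ : P.-integrable setT (EFin \o (fun x => Y x * Z x)).
  apply: (@ae_integrable _ _ _ P (fun x => Y x * pos Z x)).
  - exact: mM.
  - by move: (mulE _ Z0); apply: filterS => x ->.
  apply/integrableP; split; first exact/measurable_EFinP/mM/mpos.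
  have GT1 := sigma_algebra_setT sG.
  under eq_integral do rewrite /= ger0_norm ?mulr_ge0//.
  rewrite -(intE _ GT1) Rintegral_EFin// ltry//.
split => //; apply: Rintegral_is_cond_exp => //.
  by apply: measurable_funM.
move=> A GA; have mA := GT GA.
rewrite (ae_Rintegral mA (mM _ mWT) (mM _ (mpos _ mWT)) (mulE _ W0)).
rewrite (ae_Rintegral mA (mM _ mZ) (mM _ (mpos _ mZ)) (mulE _ Z0)).
by rewrite /Rintegral intE.
Qed.

End one_sigma_algebra.
End conditional_expectations.

(** * Convex hulls *)

Section hull.
Context {d : measure_display} {T : measurableType d} {R : realType}.
Implicit Types (P Q : probability T R) (M : set (probability T R)).
Implicit Types (F : nat -> set (set T)) (f g h : nat -> T -> R).

(** The sense in which convex combinations determine a measure: equality in [probability T R] would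
    also compare values on nonmeasurable sets. *)
Definition eq_on_measurable P Q := forall A, measurable A -> P A = Q A.

Lemma eq_on_measurable_ae P Q (phi : T -> Prop) : eq_on_measurable P Q ->
  {ae P, forall x, phi x} -> {ae Q, forall x, phi x}.
Proof. by move=> PQ [A [mA PA0 sA]]; exists A; split => //; rewrite -PQ. Qed.

Lemma eq_on_measurable_integral P Q A (X : T -> \bar R) :
  eq_on_measurable P Q ->
  (\int[P]_(x in A) X x = \int[Q]_(x in A) X x)%E.
Proof. by move=> PQ; apply: eq_measure_integral => B mB _; exact: PQ. Qed.

Lemma eq_on_measurable_integrable P Q (X : T -> R) : eq_on_measurable P Q ->
  P.-integrable setT (EFin \o X) -> Q.-integrable setT (EFin \o X).
Proof.
move=> PQ /integrableP[mX Xoo]; apply/integrableP; split => //.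
by rewrite -(eq_on_measurable_integral _ _ PQ).
Qed.

Lemma eq_on_measurable_is_cond_exp P Q (G : set (set T)) (X Y : T -> R) :
  eq_on_measurable P Q -> is_cond_exp P G X Y -> is_cond_exp Q G X Y.
Proof.
move=> PQ [mY iY YX]; split => // [|A GA].
  exact: eq_on_measurable_integrable iY.
by rewrite -2!(eq_on_measurable_integral _ _ PQ) YX.
Qed.

(** Both sides have the same set of versions, so [xget] picks the same function and the equality
    holds everywhere. *)
Lemma eq_on_measurable_cond_exp P Q (G : set (set T)) (X : T -> R) :
  eq_on_measurable P Q -> cond_exp P G X = cond_exp Q G X.
Proof.
move=> PQ; congr xget; apply/funext => Y; apply/propext.
split; apply: eq_on_measurable_is_cond_exp => // A mA.
by rewrite PQ.
Qed.

(** Convexity is given for two measures; the first weight t is split off and the remaining ones are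
    divided by 1 - t. *)
Lemma convex_combination M n (Ph : 'I_n -> probability T R) (gamma : 'I_n -> R) :
  convex_measures M -> (forall i, M (Ph i)) -> (forall i, 0 <= gamma i) ->
  \sum_(i < n) gamma i = 1 ->
  exists2 S, M S & forall A, measurable A ->
    (S A = \sum_(i < n) (gamma i)%:E * Ph i A)%E.
Proof.
move=> Mconvex; elim: n => [|n IHn] in Ph gamma *.
  by move=> _ _ /eqP; rewrite big_ord0 eq_sym oner_eq0.
move=> MP gamma0; rewrite big_ord_recl => sum1.
pose t := gamma ord0.
have sumE : \sum_(i < n) gamma (lift ord0 i) = 1 - t.
  by rewrite -sum1 /t addrAC subrr add0r.
have t1 : t <= 1 by rewrite -subr_ge0 -sumE sumr_ge0.
(* For t = 1 the remaining weights vanish and cannot be normalised; the first measure itself is then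
   the combination. *)
have [t_eq1|t_neq1] := eqVneq t 1.
  exists (Ph ord0) => // A mA; rewrite big_ord_recl -/t t_eq1 mul1e.
  rewrite big1 ?adde0// => i _.
  suff -> : gamma (lift ord0 i) = 0 by rewrite mul0e.
  move/eqP: sumE; rewrite t_eq1 subrr psumr_eq0// => /allP/(_ i).
  by rewrite mem_index_enum => /(_ isT)/eqP.
have t1' : 0 < 1 - t by rewrite subr_gt0 lt_neqAle t_neq1.
have [i||S MS SE] := IHn (fun i => Ph (lift ord0 i))
    (fun i => gamma (lift ord0 i) / (1 - t)) (fun i => MP _).
- by rewrite divr_ge0// ltW.
- by rewrite -mulr_suml sumE divff// gt_eqF.
have [|S' MS' S'E] := Mconvex (Ph ord0) S t (MP _) MS.
  by rewrite gamma0.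
exists S' => // A mA; rewrite S'E// SE// big_ord_recl -/t; congr (_ + _)%E.
rewrite ge0_sume_distrr => [|i _]; last first.
  by rewrite mule_ge0 ?lee_fin ?divr_ge0// ltW.
apply: eq_bigr => i _; rewrite muleA -EFinM.
by rewrite mulrCA divff ?mulr1// gt_eqF.
Qed.

(** Through this lemma, almost sure relations and martingale properties relative to M carry over to
    the hull of a finite family. *)
Lemma hull_sub M n (Ph : 'I_n -> probability T R) Q :
  convex_measures M -> (forall i, M (Ph i)) -> hull Ph Q ->
  exists2 S, M S & eq_on_measurable S Q.
Proof.
move=> Mconvex MP [gamma [gamma0 sum1 QE]].
have [S MS SE] := convex_combination Mconvex MP gamma0 sum1.
by exists S => // A mA; rewrite SE ?QE.
Qed.

Lemma hull_gen n (Ph : 'I_n -> probability T R) i : hull Ph (Ph i).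
Proof.
exists (fun j => (j == i)%:R); split => [j||A mA].
- exact: ler0n.
- by rewrite (bigD1 i)//= eqxx big1 ?addr0// => j /negbTE ->.
- rewrite (bigD1 i)//= eqxx mul1e big1 ?adde0// => j /negbTE ->.
  by rewrite mul0e.
Qed.

Lemma martingale_eq_on_measurable M M' F f :
  (forall Q, M' Q -> exists2 S, M S & eq_on_measurable S Q) ->
  martingale M F f -> martingale M' F f.
Proof.
move=> M'M [af intf ce]; split => // [m Q m1 /M'M[S MS SQ]|k m Q km /M'M[S MS SQ]].
  exact: (eq_on_measurable_integrable SQ (intf _ _ m1 MS)).
rewrite -(eq_on_measurable_cond_exp _ _ SQ).
exact: (eq_on_measurable_ae SQ (ce _ _ _ km MS)).
Qed.

End hull.

(** * Supermartingales *)

Section filtrations.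
Context {d : measure_display} {T : measurableType d} {R : realType}.
Implicit Types (P Q : probability T R) (M : set (probability T R)).
Implicit Types (F : nat -> set (set T)) (f g h : nat -> T -> R).

Lemma filtration_le F i j : filtration F -> (i <= j)%N -> F i `<=` F j.
Proof.
move=> [_ _ FS]; elim: j => [|j IH]; first by rewrite leqn0 => /eqP ->.
by rewrite leq_eqVlt => /orP[/eqP -> //|]; rewrite ltnS => /IH h A /h /FS.
Qed.

Lemma measurable_wrt_le F i j (X : T -> R) : filtration F -> (i <= j)%N ->
  measurable_wrt (F i) X -> measurable_wrt (F j) X.
Proof.
move=> hF ij; have [sF _ _] := hF.
exact: measurable_wrt_sub (filtration_le hF ij).
Qed.

Lemma adapted_measurable F f m : filtration F -> adapted F f ->
  measurable_fun setT (f m).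
Proof. by move=> [sF FT _] /(_ m); exact: measurable_wrt_measurable. Qed.

Lemma martingale_supermartingale M F f :
  martingale M F f -> supermartingale M F f.
Proof.
move=> [af intf ce]; split => // k m P km MP.
by have := ce _ _ _ km MP; apply: filterS => x ->.
Qed.

(** A set of F_k belongs to every later F_j, so the one-step equalities chain from m down to k. *)
Lemma martingale_of_steps M F f : filtration F -> adapted F f ->
  (forall m P, M P -> P.-integrable setT (EFin \o f m)) ->
  (forall m P A, M P -> F m A ->
    \int[P]_(x in A) f m.+1 x = \int[P]_(x in A) f m x) ->
  martingale M F f.
Proof.
move=> hF af intf step; have [sF FT _] := hF.
split => // [m P _|k m P km MP]; first exact: intf.
apply: cond_exp_ae => //; apply: Rintegral_is_cond_exp => //; try exact: intf.
move=> A FA; rewrite -(subnKC km); elim: (m - k)%N => [|i ->]; first by rewrite addn0.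
by rewrite addnS step//; apply: (filtration_le hF) FA; rewrite leq_addr.
Qed.

Lemma supermartingale_Rintegral M F f P k m A : filtration F ->
  supermartingale M F f -> M P ->
  P.-integrable setT (EFin \o f k) -> P.-integrable setT (EFin \o f m) ->
  (k <= m)%N -> F k A ->
  \int[P]_(x in A) f m x <= \int[P]_(x in A) f k x.
Proof.
move=> [sF FT _] [_ _ ce] MP ik im km FA.
have C := cond_expP (sF k) (FT k) im; have [_ iC _] := C.
rewrite -(is_cond_exp_Rintegral im C FA).
by apply: ae_le_Rintegral => //; [exact: FT FA|exact: ce].
Qed.

Lemma martingale_Rintegral M F f P k m A : filtration F ->
  martingale M F f -> M P ->
  P.-integrable setT (EFin \o f k) -> P.-integrable setT (EFin \o f m) ->
  (k <= m)%N -> F k A ->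
  \int[P]_(x in A) f m x = \int[P]_(x in A) f k x.
Proof.
move=> [sF FT _] [_ _ ce] MP ik im km FA.
have C := cond_expP (sF k) (FT k) im; have [_ iC _] := C.
rewrite -(is_cond_exp_Rintegral im C FA).
apply: ae_Rintegral; first exact: FT FA.
- exact: integrable_measurable iC.
- exact: integrable_measurable ik.
- exact: ce.
Qed.

(** [supermartingale] asks for integrability from time 1 on; at time 0 the variable is constant
    because F_0 is trivial. *)
Lemma supermartingale_integrable M F f P m : F 0%N = [set set0; setT] ->
  supermartingale M F f -> M P -> P.-integrable setT (EFin \o f m).
Proof.
move=> F0 [af intf _] MP; case: m => [|m]; last exact: intf.
have := af 0%N; rewrite F0 => /measurable_wrt_trivial[c ->].
exact: (finite_measure_integrable_cst P c).
Qed.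

(** For k <= K the claim is the property of f between k and min(m, K). For k > K both sides are f_K,
    which is already F_k-measurable. *)
Lemma supermartingale_stopped M F f K : filtration F ->
  F 0%N = [set set0; setT] ->
  supermartingale M F f -> supermartingale M F (fun m => f (minn m K)).
Proof.
move=> hF F0 sf; have [af intf ce] := sf; have [sF FT _] := hF.
have intf' m P : M P -> P.-integrable setT (EFin \o f m).
  exact: (supermartingale_integrable _ F0 sf).
split => [m|m P _ MP|k m P km MP].
- by apply: (measurable_wrt_le hF (geq_minl m K)); exact: af.
- exact: intf'.
have [kK|Kk] := leqP k K.
  by apply: ce => //; rewrite leq_min km.
rewrite (minn_idPr (leq_trans (ltnW Kk) km)).
have C : is_cond_exp P (F k) (f K) (f K).
  split => //; last exact: intf'.
  by apply: (measurable_wrt_le hF (ltnW Kk)); exact: af.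
by have := cond_exp_ae (sF k) (FT k) C; apply: filterS => x ->.
Qed.

End filtrations.

(** * Maximal chains through a given element *)

Section maximal_chains.

(** Zorn's lemma is applied to the sets D for which D together with g is a chain, so that the
    maximal chain contains g by construction. The empty union is covered by reflexivity at g. *)
Lemma maximal_chain_exists (U : Type) (le : U -> U -> Prop) (E : set U) (g : U) :
  E g -> le g g -> exists2 C, maximal_chain le E C & C g.
Proof.
move=> Eg gg.
pose chain (D : set U) := D `<=` E /\ total_on D le.
have [|C [[CE tC] Cmax]] := @Zorn_bigcup U (fun D => chain (g |` D)).
  move=> D Dchain tD; split => [u [->//|[X DX Xu]]|u v].
    by case: (Dchain _ DX) => XE _; apply: XE; right.
  move=> [->|[X DX Xu]] [->|[Y DY Yv]].
  - by left.
  - by have [_ tY] := Dchain _ DY; apply: tY; [left|right].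
  - by have [_ tX] := Dchain _ DX; apply: tX; [right|left].
  - have [XY|YX] := tD _ _ DX DY.
      by have [_ tY] := Dchain _ DY; apply: tY; right => //; exact: XY.
    by have [_ tX] := Dchain _ DX; apply: tX; right => //; exact: YX.
exists (g |` C); last by left.
split => // D DE tD gCD; apply/seteqP; split => // u Du.
apply: contrapT => nCu; apply: (Cmax D).
  split=> [v Cv|/(_ u Du) Cu]; first by apply: gCD; right.
  by apply: nCu; right.
have -> : g |` D = D; last by split.
by apply/seteqP; split => [v [->|//]|v Dv]; [apply: gCD; left|right].
Qed.

End maximal_chains.

(** * From local regularity to the ratio bound *)

Section necessity.
Context {d : measure_display} {T : measurableType d} {R : realType}.
Implicit Types (P Q : probability T R) (M : set (probability T R)).
Implicit Types (F : nat -> set (set T)) (f g h : nat -> T -> R).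

Lemma cond_exp_Rintegral P (G : set (set T)) (X Y : T -> R) A :
  sigma_algebra setT G -> G `<=` measurable ->
  P.-integrable setT (EFin \o X) -> measurable_fun setT Y ->
  {ae P, forall x, cond_exp P G X x = Y x} -> G A ->
  \int[P]_(x in A) Y x = \int[P]_(x in A) X x.
Proof.
move=> sG GT iX mY XY GA; have C := cond_expP sG GT iX.
rewrite -(is_cond_exp_Rintegral iX C GA); apply/esym/ae_Rintegral => //.
  exact: GT.
by case: C => _ /integrable_measurable.
Qed.

Lemma ae_ge0_integrable P (X : T -> R) : measurable_fun setT X ->
  {ae P, forall x, 0 <= X x} -> ('E_P[X] < +oo)%E ->
  P.-integrable setT (EFin \o X).
Proof.
move=> mX X0; rewrite unlock => Xoo; apply/integrableP.
have mEX : measurable_fun setT (EFin \o X) by exact/measurable_EFinP.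
split => //; rewrite (_ : (\int[P]_x _ = \int[P]_x (X x)%:E)%E)//.
have XE : ae_eq P setT (abse \o (EFin \o X)) (EFin \o X).
  by apply: filterS X0 => x X0 _ /=; rewrite ger0_norm.
by apply: (ae_eq_integral _ _ _ _ _ XE) => //; exact: measurable_abse_EFin.
Qed.

(** The compensator g of a one-element family depends on P, but its increment at m has the same
    conditional expectation as [gb m], which was fixed before P. Integrating both identities over
    sets of F_(m-1) eliminates g. *)
Lemma regular_cond_exp M F f K m : filtration F -> F 0%N = [set set0; setT] ->
  supermartingale M F f -> regular M F (fun m => f (minn m K)) ->
  (1 <= m <= K)%N ->
  exists gbar : T -> R, [/\ measurable_wrt (F m) gbar,
    as_le M (cst 0) gbar & forall P, M P ->
     P.-integrable setT (EFin \o gbar) /\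
     is_cond_exp P (F m.-1) (fun x => f m x + gbar x) (f m.-1)].
Proof.
move=> hF F0 sf [sfK _ [gb [agb gb0 _ gbfin gbP]]] /andP[m1 mK].
exists (gb m); split => // P MP; have [sF FT _] := hF.
(* The family consists of P alone; its density with respect to itself is 1, whence the bounds l = L
   = 1. *)
have [_ [C [g [[CE _ _] [Cg _] mart incr]]]] :=
  gbP 0%N (fun=> P) 1 1 (fun=> MP) ltr01 (@density_self _ _ _ P 1).
have [ag _ g0 sfg] := CE _ Cg.
have ifm j := supermartingale_integrable j F0 sf MP.
(* Membership in [increments] gives integrability of f + g only, so f is subtracted. *)
have ig j : P.-integrable setT (EFin \o g j).
  have := supermartingale_integrable j F0 sfg (hull_gen (fun=> P) ord0).
  move=> /integrableBr/(_ (ifm (minn j K))).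
  by congr (integrable _ _ (EFin \o _)); apply/funext => x; rewrite addrAC subrr add0r.
have igb : P.-integrable setT (EFin \o gb m).
  apply: ae_ge0_integrable; first exact: adapted_measurable agb.
  - exact: gb0.
  - exact: gbfin.
split => //; apply: Rintegral_is_cond_exp => //.
- by have [af _ _] := sf.
- exact: integrableDr.
move=> A FA; have mA : measurable A by exact: FT FA.
have {mart} := mart m.-1 m ord0 (leq_pred m) m1 P MP.
rewrite (minn_idPl mK) (minn_idPl (leq_trans (leq_pred m) mK)) => mart.
have mfg : measurable_fun setT (fun x => f m.-1 x + g m.-1 x).
  exact: integrable_measurable (integrableDr (ifm m.-1) (ig m.-1)).
have := cond_exp_Rintegral (sF _) (FT _) (integrableDr (ifm m) (ig m)) mfg mart FA.
have igg := integrableBr (ig m) (ig m.-1).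
have C' := cond_expP (sF m.-1) (FT m.-1) igb.
have mC' : measurable_fun setT (cond_exp P (F m.-1) (gb m)).
  by case: C' => _ /integrable_measurable.
have := cond_exp_Rintegral (sF _) (FT _) igg mC' (incr m ord0 m1 P MP) FA.
rewrite (is_cond_exp_Rintegral igb C' FA).
rewrite RintegralB ?RintegralD//; try exact: integrableTS.
move=> -> e; rewrite addrA -e addrK//.
Qed.

(** With D = {f_(m-1) > 0}, Y the inverse of f_(m-1) on D and 0 elsewhere, I the indicator of the
    complement of D and Z = f_m + gbar_m, the variable is xi = Y Z + I. Its conditional expectation
    is Y f_(m-1) + I = 1. *)
Lemma local_regular_ratio M F f m : filtration F ->
  F 0%N = [set set0; setT] -> (forall m, as_le M (cst 0) (f m)) ->
  local_regular M F f -> (1 <= m)%N ->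
  exists xi : T -> R,
    [/\ measurable_wrt (F m) xi,
        A0 M xi,
        as_le M (fun x => f m x / f m.-1 x) xi &
        forall P, M P -> {ae P, forall x, cond_exp P (F m.-1) xi x = 1}].
Proof.
move=> hF F0 f0 [sf _ [k [ik _ reg]]] m1; have [sF FT _] := hF.
have [af _ _] := sf.
(* A strictly increasing sequence of naturals satisfies m <= k_m, so stopping at k_m leaves the step
   from m-1 to m intact. *)
have mk : (m <= k m)%N.
  elim: m {m1} => // m /leq_ltn_trans; apply.
  have : (k m < k m.+1)%O by rewrite (leW_mono ik) ltEnat/=.
  by rewrite ltEnat.
have [|gb [mgb gb0 gbP]] := regular_cond_exp hF F0 sf (reg m) (m := m).
  by rewrite m1.
pose D x := 0 < f m.-1 x.
have mf : measurable_fun [set: g_sigma_algebraType (F m.-1)] (f m.-1).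
  exact: af.
have mD : measurable_fun [set: g_sigma_algebraType (F m.-1)] D.
  by apply: measurable_fun_ltr => //.
(* The power -1 is the inverse on D and is a measurable function. *)
pose Y x : R := if D x then f m.-1 x `^ (-1) else 0.
pose I x : R := if D x then 0 else 1.
pose Z x : R := f m x + gb x.
have mI : measurable_wrt (F m.-1) I by exact: measurable_fun_ifT.
have mY : measurable_wrt (F m.-1) Y.
  apply: measurable_fun_ifT => //.
  exact: (measurableT_comp (measurable_powR (-1)) mf).
have YE x : Y x = if D x then (f m.-1 x)^-1 else 0.
  by rewrite /Y /D; case: ifPn => // /ltW /powR_inv1.
have Y0 x : 0 <= Y x.
  by rewrite YE /D; case: ifPn => // /ltW; rewrite invr_ge0.
have mZ : measurable_wrt (F m) Z by apply: measurable_funD => //; exact: af.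
pose xi x := Y x * Z x + I x.
have xiE x : xi x = if D x then Z x / f m.-1 x else 1.
  by rewrite /xi YE /I; case: ifPn; rewrite ?addr0 1?mulrC ?mulr0 ?add0r.
have mleq X : measurable_wrt (F m.-1) X -> measurable_wrt (F m) X.
  exact: measurable_wrt_le (leq_pred m).
have oneE x : Y x * f m.-1 x + I x = 1.
  rewrite YE /I /D; case: ifPn => [h|_]; last by rewrite mul0r add0r.
  by rewrite addr0 mulVf ?gt_eqF.
have ic1 P : P.-integrable setT (EFin \o cst 1).
  exact: finite_measure_integrable_cst.
have iI P : P.-integrable setT (EFin \o I).
  apply: le_integrable (ic1 P) => //.
    by apply/measurable_EFinP; apply: (measurable_wrt_measurable (sF _) (FT _) mI).
  move=> x _ /=; rewrite lee_fin normr1 /I.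
  by case: ifP; rewrite ?normr0 ?normr1.
have key P : M P -> P.-integrable setT (EFin \o xi) /\
    is_cond_exp P (F m.-1) xi (cst 1).
  move=> MP; have [igb Zf] := gbP _ MP.
  have ifm j := supermartingale_integrable j F0 sf MP.
  have iZ : P.-integrable setT (EFin \o Z) by exact: integrableDr.
  (* Y f_(m-1) = 1 - I is bounded. *)
  have iYf : P.-integrable setT (EFin \o (fun x => Y x * f m.-1 x)).
    have := integrableBr (ic1 P) (iI P).
    congr (integrable _ _ (EFin \o _)); apply/funext => x.
    by rewrite /= -(oneE x) addrK.
  have Z0 : {ae P, forall x, 0 <= Z x}.
    apply: filterS2 (f0 m P MP) (gb0 P MP) => x; exact: addr_ge0.
  have [iYZ cYZ] := is_cond_exp_mul (sF _) (FT _) mY Y0 iZ Zf Z0 iYf.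
  have ixi : P.-integrable setT (EFin \o xi) by exact: integrableDr.
  split => //; apply: Rintegral_is_cond_exp => //.
  - exact: measurable_cst.
  - move=> A FA; have mA := FT _ _ FA.
    have -> : \int[P]_(x in A) cst 1 x =
        \int[P]_(x in A) (Y x * f m.-1 x + I x).
      by apply: eq_Rintegral => x _; rewrite oneE.
    rewrite !RintegralD//; try exact: integrableTS.
    by rewrite (is_cond_exp_Rintegral iYZ cYZ FA).
exists xi; split.
- by apply: measurable_funD; [apply: measurable_funM => //|]; exact: mleq.
- split => [P MP|P /key[]//|P /key[ixi [_ _ c1]]].
    apply: filterS2 (f0 m P MP) (gb0 P MP) => x /= h1 h2; rewrite xiE /D.
    by case: ifPn => // /ltW h; rewrite divr_ge0// addr_ge0.
  rewrite unlock -c1; last exact: sigma_algebra_setT.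
  by have := expectation_cst P 1; rewrite unlock.
- move=> P MP; apply: filterS2 (f0 m.-1 P MP) (gb0 P MP) => x /= h1 h2.
  rewrite xiE /D; case: ifPn => [h|]; first by rewrite ler_pM2r ?invr_gt0// lerDl.
  (* Off D, f_(m-1) is a.s. 0; the quotient is then 0 by the convention on division by zero, below
     xi = 1. *)
  rewrite -leNgt => h; have -> : f m.-1 x = 0 by apply/eqP; rewrite eq_le h h1.
  by rewrite invr0 mulr0.
- by move=> P /key[_]; exact: cond_exp_ae.
Qed.

End necessity.

(** * From the ratio bound to local regularity *)

Section sufficiency.
Context {d : measure_display} {T : measurableType d} {R : realType}.
Context (M : set (probability T R)) (F : nat -> set (set T)).
Context (f xi : nat -> T -> R).
Hypotheses (hF : filtration F) (F0 : F 0%N = [set set0; setT]).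
Hypotheses (Mconvex : convex_measures M) (Mequiv : mutually_equivalent M).
Hypotheses (sf : supermartingale M F f).
Hypothesis f0 : forall m, as_le M (cst 0) (f m).
Hypothesis xiP : forall m, (1 <= m)%N ->
  [/\ measurable_wrt (F m) (xi m),
      A0 M (xi m),
      as_le M (fun x => f m x / f m.-1 x) (xi m) &
      forall P, M P -> {ae P, forall x, cond_exp P (F m.-1) (xi m) x = 1}].
Implicit Types (P Q : probability T R).

Let sF : forall m, sigma_algebra setT (F m). Proof. by case: hF. Qed.
Let FT : forall m, F m `<=` measurable. Proof. by case: hF. Qed.
Let af : adapted F f. Proof. by case: sf. Qed.
Let ifm P m : M P -> P.-integrable setT (EFin \o f m).
Proof. exact: (supermartingale_integrable m F0 sf). Qed.

(** Where f_(m-1) = 0 the quotient is 0 by convention and the ratio bound says nothing about f_m.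
    There f_m = 0 a.s., since its integral over {f_(m-1) <= 0} is at most that of f_(m-1). *)
Let f_le m P : (1 <= m)%N -> M P ->
  {ae P, forall x, f m x <= f m.-1 x * xi m x}.
Proof.
move=> m1 MP; have [_ _ ratio _] := xiP m1.
pose A := f m.-1 @^-1` `]-oo, 0].
have FA : F m.-1 A.
  by apply: measurable_wrt_preimage => //; exact: (af m.-1).
have mA := FT FA.
have fA : {ae P, forall x, A x -> f m x = 0}.
  apply: ae_eq0_Rintegral => //; first exact: ifm.
    by apply: filterS (f0 m MP).
  apply: (@le_trans _ _ (\int[P]_(x in A) f m.-1 x)).
    apply: (supermartingale_Rintegral hF sf MP) => //; try exact: ifm.
    exact: leq_pred.
  have <- : \int[P]_(x in A) (cst 0 x) = 0 by rewrite Rintegral_cst// mul0r.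
  apply: le_Rintegral => //.
  - by apply: integrableTS => //; exact: ifm.
  - exact: (finite_measure_integrable_cst P 0).
move: (f0 m.-1 MP) (ratio P MP) fA; apply: filterS3 => x /= h0 hr hA.
have [fpos|fle0] := ltP 0 (f m.-1 x).
  by rewrite mulrC -ler_pdivrMr.
have -> : f m x = 0 by apply: hA; rewrite /A/= in_itv.
have -> : f m.-1 x = 0 by apply/eqP; rewrite eq_le h0 fle0.
by rewrite mul0r.
Qed.

(** The factor f_(m-1) is pulled out of E^P(xi_m | F_(m-1)) = 1. It must be nonnegative everywhere
    for [is_cond_exp_mul], whence the a.s. equal truncation Y = max(0, f_(m-1)). *)
Let f_xi m P : (1 <= m)%N -> M P ->
  P.-integrable setT (EFin \o (fun x => f m.-1 x * xi m x)) /\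
  forall A, F m.-1 A ->
    \int[P]_(x in A) (f m.-1 x * xi m x) = \int[P]_(x in A) f m.-1 x.
Proof.
move=> m1 MP; have [mxi [xi0 ixi _] _ /(_ P MP) cxi] := xiP m1.
have {}xi0 := xi0 P MP; have {}ixi := ixi P MP.
have mxiT := measurable_wrt_measurable (sF m) (@FT m) mxi.
have mfT := adapted_measurable m.-1 hF af.
pose Y x := Num.max 0 (f m.-1 x).
have mY : measurable_wrt (F m.-1) Y.
  by apply: measurable_maxr => //; exact: af.
have mYT := measurable_wrt_measurable (sF m.-1) (@FT m.-1) mY.
have Y0 x : 0 <= Y x by rewrite le_max lexx.
have YE : {ae P, forall x, f m.-1 x = Y x}.
  by apply: filterS (f0 m.-1 MP) => x /max_idPr.
have iY := ae_integrable mYT YE (ifm m.-1 MP).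
have xi1 : is_cond_exp P (F m.-1) (xi m) (cst 1).
  apply: Rintegral_is_cond_exp => //.
  - exact: measurable_cst.
  - exact: finite_measure_integrable_cst.
  - by move=> A; apply: cond_exp_Rintegral.
have iY1 : P.-integrable setT (EFin \o (fun x => Y x * cst 1 x)).
  by congr (integrable _ _ (EFin \o _)) : iY; apply/funext => x; rewrite mulr1.
have [iYxi cYxi] := is_cond_exp_mul (sF _) (@FT _) mY Y0 ixi xi1 xi0 iY1.
have mfxi : measurable_fun setT (fun x => f m.-1 x * xi m x).
  exact: measurable_funM.
have YxiE : {ae P, forall x, Y x * xi m x = f m.-1 x * xi m x}.
  by apply: filterS YE => x ->.
split; first exact: ae_integrable YxiE iYxi.
move=> A FA; have mA := FT FA.
rewrite -(ae_Rintegral mA _ mfxi YxiE); last exact: measurable_funM.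
rewrite -(is_cond_exp_Rintegral iYxi cYxi FA).
rewrite (ae_Rintegral mA mfT mYT YE).
by apply: eq_Rintegral => x _; rewrite mulr1.
Qed.

Let loss m x := f m.-1 x * xi m x - f m x.

Let loss_ge0 m : (1 <= m)%N -> as_le M (cst 0) (loss m).
Proof. by move=> m1 P /(f_le m1); apply: filterS => x; rewrite subr_ge0. Qed.

Let iloss m P : (1 <= m)%N -> M P -> P.-integrable setT (EFin \o loss m).
Proof.
by move=> m1 MP; apply: integrableBr; [case: (f_xi m1 MP)|exact: ifm].
Qed.

Let mloss m : (1 <= m)%N -> measurable_wrt (F m) (loss m).
Proof.
move=> m1; have [mxi _ _ _] := xiP m1.
apply: measurable_funB; last exact: af.
apply: measurable_funM => //.
by apply: (measurable_wrt_le hF (leq_pred m)); exact: af.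
Qed.

Let Rintegral_loss m P A : (1 <= m)%N -> M P -> F m.-1 A ->
  \int[P]_(x in A) loss m x =
  \int[P]_(x in A) f m.-1 x - \int[P]_(x in A) f m x.
Proof.
move=> m1 MP FA; have mA := FT FA; have [ifx fxE] := f_xi m1 MP.
rewrite RintegralB ?fxE//; apply: integrableTS => //; exact: ifm.
Qed.

(** If each loss vanished a.s. under some measure of M, it would vanish under all by equivalence,
    and f would have equal integrals at m and m+1 over sets of F_m. The index m found here serves
    all measures at once. *)
Lemma loss_not_ae0 : ~ martingale M F f ->
  exists2 m, (1 <= m)%N & forall P, M P -> ~ {ae P, forall x, loss m x = 0}.
Proof.
move=> nmart; apply: contrapT => noloss; apply: nmart.
apply: martingale_of_steps => // [m P|m P A MP FA]; first exact: ifm.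
have [Q MQ loss0] : exists2 Q, M Q & {ae Q, forall x, loss m.+1 x = 0}.
  apply: contrapT => h; apply: noloss; exists m.+1 => // Q MQ loss0.
  by apply: h; exists Q.
have {}loss0 := ae_equiv Mequiv MQ MP loss0.
have mA := FT FA.
have := Rintegral_loss (ltn0Sn m) MP FA.
have -> : \int[P]_(x in A) loss m.+1 x = \int[P]_(x in A) (cst 0 x).
  apply: ae_Rintegral loss0 => //.
  exact: integrable_measurable (iloss (ltn0Sn m) MP).
rewrite Rintegral_cst// mul0r => /esym/eqP; rewrite subr_eq0.
by move/eqP => ->.
Qed.

(** * The compensator of the stopped process *)

Section stopped.
Variable K : nat.

(** The losses are cut off after time K, when the stopped process no longer moves, and at index 0,
    where regularity requires the value 0. *)
Let gbar m : T -> R := if (1 <= m <= K)%N then loss m else cst 0.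
Let g m x : R := \sum_(i < m) gbar i.+1 x.
Let h m x : R := f (minn m K) x + g m x.

Let gbar_ge0 m : as_le M (cst 0) (gbar m).
Proof.
move=> P MP; rewrite /gbar; case: ifPn => [/andP[m1 _]|_].
  exact: loss_ge0.
exact: aeW.
Qed.

Let agbar : adapted F gbar.
Proof.
move=> m; rewrite /gbar; case: ifPn => [/andP[m1 _]|_]; first exact: mloss.
exact: measurable_cst.
Qed.

Let igbar m P : M P -> P.-integrable setT (EFin \o gbar m).
Proof.
move=> MP; rewrite /gbar; case: ifPn => [/andP[m1 _]|_]; first exact: iloss.
exact: (finite_measure_integrable_cst P 0).
Qed.

Let gS m x : g m.+1 x = g m x + gbar m.+1 x.
Proof. by rewrite /g big_ord_recr. Qed.

Let g0 : g 0%N = cst 0.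
Proof. by apply/funext => x; rewrite /g big_ord0. Qed.

Let ag : adapted F g.
Proof.
elim=> [|m IH]; first by rewrite g0; exact: measurable_cst.
rewrite (_ : g m.+1 = fun x => g m x + gbar m.+1 x); last first.
  by apply/funext => x; rewrite gS.
apply: measurable_funD; last exact: agbar.
exact: (measurable_wrt_le hF (leqnSn m)).
Qed.

Let ig m P : M P -> P.-integrable setT (EFin \o g m).
Proof.
move=> MP; elim: m => [|m IH].
  by rewrite g0; exact: (finite_measure_integrable_cst P 0).
rewrite (_ : g m.+1 = fun x => g m x + gbar m.+1 x); last first.
  by apply/funext => x; rewrite gS.
by apply: integrableDr => //; exact: igbar.
Qed.

Let ih m P : M P -> P.-integrable setT (EFin \o h m).
Proof. by move=> MP; apply: integrableDr; [exact: ifm|exact: ig]. Qed.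

Let sfK : supermartingale M F (fun m => f (minn m K)).
Proof. exact: supermartingale_stopped. Qed.

(** For m < K the added loss offsets the decrease of f in integral over every set of F_m; for m >= K
    neither summand changes. *)
Lemma compensated_martingale : martingale M F h.
Proof.
apply: (martingale_of_steps hF) => [m|m P MP|m P A MP FA].
- by apply: measurable_funD; [case: sfK => a _ _; exact: a|exact: ag].
- exact: ih.
have mA := FT FA.
have IA m' := integrableTS mA (ifm m' MP).
have IG m' := integrableTS mA (ig m' MP).
have IGB m' := integrableTS mA (igbar m' MP).
transitivity (\int[P]_(x in A) (f (minn m.+1 K) x + (g m x + gbar m.+1 x))).
  by apply: eq_Rintegral => x _; rewrite /h gS.
rewrite /h !RintegralD//; last by apply: integrableTS => //; apply: integrableDr; [exact: ig|exact: igbar].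
rewrite addrCA [RHS]addrC; congr (_ + _).
rewrite /gbar ltn0Sn/=; case: (boolP (m < K)%N) => mK.
  by rewrite (minn_idPl mK) (minn_idPl (ltnW mK)) Rintegral_loss//= addrC subrK.
move: mK; rewrite -leqNgt => Km.
by rewrite (minn_idPr Km) (minn_idPr (leqW Km)) Rintegral_cst// mul0r addr0.
Qed.


(** * Maximality and strict decrease for a finite family of measures *)

Section finite_family.
Variables (s : nat) (Ph : 'I_s.+1 -> probability T R).
Hypothesis MPh : forall i, M (Ph i).

Let hull_as_le X Y : as_le M X Y -> as_le (hull Ph) X Y.
Proof.
move=> XY Q /(hull_sub Mconvex MPh)[S MS SQ].
exact: (eq_on_measurable_ae SQ (XY S MS)).
Qed.

Let mart_hull : martingale (hull Ph) F h.
Proof.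
apply: martingale_eq_on_measurable compensated_martingale => Q.
exact: hull_sub.
Qed.

Let increments_g : increments (hull Ph) F (fun m => f (minn m K)) g.
Proof.
split => [|m||].
- exact: ag.
- apply: hull_as_le => P MP; apply: filterS (gbar_ge0 m.+1 MP) => x.
  by rewrite gS lerDl.
- exact: g0.
- exact: martingale_supermartingale.
Qed.

(* Any increasing process u in the set satisfies
   E(f_m + u_m) <= f_0 = E(f_m + g_m). *)
Let g_maximal u : increments (hull Ph) F (fun m => f (minn m K)) u ->
  process_le (hull Ph) g u -> process_le (hull Ph) u g.
Proof.
move=> [_ _ u0 su] gu m Q HQ.
have [S MS SQ] := hull_sub Mconvex MPh HQ.
have ihQ j := eq_on_measurable_integrable SQ (ih j MS).
have iuQ j := supermartingale_integrable j F0 su HQ.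
have FT0 : F 0%N setT by exact: sigma_algebra_setT.
(* This difference is u_m - g_m, a.s. nonnegative by assumption; its integral is at most 0 because
   both processes start at f_0. *)
have : {ae Q, forall x, setT x ->
    (f (minn m K) x + u m x) - h m x = 0}.
  apply: ae_eq0_Rintegral => //.
  - exact: integrableBr.
  - apply: filterS (gu m Q HQ) => x gux _.
    by rewrite subr_ge0 lerD2l.
  - rewrite RintegralB// subr_le0.
    rewrite (martingale_Rintegral hF mart_hull HQ (ihQ 0%N) (ihQ m))//.
    rewrite (_ : h 0%N = fun x => f (minn 0 K) x + u 0%N x); last first.
      by apply/funext => x; rewrite /h g0 u0.
    exact: (supermartingale_Rintegral hF su).
apply: filterS => x /(_ I)/eqP; rewrite subr_eq0 => /eqP/addrI ->.
exact: lexx.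
Qed.

(** Any maximal chain through [g] will do: each of its elements is comparable with [g], and by
    [g_maximal] those above [g] are also below it. *)
Lemma compensator_maximal_chain : exists C,
  maximal_chain (process_le (hull Ph))
    (increments (hull Ph) F (fun m => f (minn m K))) C /\
  maximum_of (process_le (hull Ph)) C g.
Proof.
have gg : process_le (hull Ph) g g by move=> m Q HQ; exact: aeW.
have [C maxC Cg] := maximal_chain_exists increments_g gg.
exists C; split => //; split => // u Cu.
have [CE tC _] := maxC.
by have [//|gu] := tC _ _ Cu Cg; apply: g_maximal => //; exact: CE.
Qed.

(** The witness is the minimum of the conditional expectations of [loss m] over the family. Wherever
    it is <= 0, one of them is <= 0, which forces the loss to vanish there a.s.; so it cannot be <=
    0 almost everywhere. *)
Lemma one_step_decrease m : (1 <= m)%N ->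
  (forall P, M P -> ~ {ae P, forall x, loss m x = 0}) ->
  exists phi : T -> R,
    [/\ measurable_wrt (F m.-1) phi,
        as_le M (cst 0) phi,
        (0 < Ph ord0 [set x | (0 < phi x)%R])%E &
        forall i, as_le M phi (fun x =>
          f m.-1 x - cond_exp (Ph i) (F m.-1) (f m) x)].
Proof.
move=> m1 lossm.
pose V i := cond_exp (Ph i) (F m.-1) (loss m).
have cV i : is_cond_exp (Ph i) (F m.-1) (loss m) (V i).
  by apply: cond_expP => //; exact: iloss.
(* The minimum is capped by the initial value 1; being positive, the cap affects neither the sign
   nor the upper bounds. *)
pose phi x := \big[Num.min/1]_(i < s.+1) V i x.
have mphi : measurable_wrt (F m.-1) phi.
  rewrite /phi; elim: (index_enum _) => [|i r IH].
    by under eq_fun do rewrite big_nil; exact: measurable_cst.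
  under eq_fun do rewrite big_cons.
  by apply: measurable_minr => //; case: (cV i).
exists phi; split => //.
- move=> P MP; have V0 : {ae P, forall x, forall i, 0 <= V i x}.
    apply: filter_forall => i; apply: (ae_equiv Mequiv (MPh i) MP).
    apply: (is_cond_exp_ge0 (sF _) (@FT _) _ (cV i)); first exact: iloss.
    exact: loss_ge0.
  apply: filterS V0 => x V0; exact: le_bigmin.
- rewrite lt0e measure_ge0 andbT; apply/eqP => phi0.
  apply: (lossm _ (MPh ord0)).
  have phi_le0 : {ae Ph ord0, forall x, phi x <= 0}.
    exists [set x | 0 < phi x]; split => // [|x /=].
      rewrite (_ : mkset _ = phi @^-1` `]0, +oo[%classic); last first.
        by apply/seteqP; split => x /=; rewrite in_itv/= andbT.
      by apply: (@FT m.-1); exact: measurable_wrt_preimage.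
    by move/negP; rewrite -ltNge.
  have V_loss : {ae Ph ord0, forall x, forall i, V i x <= 0 -> loss m x = 0}.
    apply: filter_forall => i; apply: (ae_equiv Mequiv (MPh i) (MPh ord0)).
    apply: (is_cond_exp_le0 (sF _) (@FT _) _ (cV i)); first exact: iloss.
    exact: loss_ge0.
  apply: filterS2 phi_le0 V_loss => x phix VX.
  apply: contrapT => lossx; move: phix; apply/negP; rewrite -ltNge.
  apply: lt_bigmin => // i _; rewrite ltNge; apply/negP => /VX.
  exact: lossx.
- move=> i P MP; apply: (ae_equiv Mequiv (MPh i) MP).
  have cf := cond_expP (sF m.-1) (@FT m.-1) (ifm m (MPh i)).
  have [mcf icf _] := cf.
  (* By [Rintegral_loss], this difference is another version of [V i]. *)
  have VE : is_cond_exp (Ph i) (F m.-1) (loss m)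
      (fun x => f m.-1 x - cond_exp (Ph i) (F m.-1) (f m) x).
    apply: Rintegral_is_cond_exp => //.
    + by apply: measurable_funB => //; exact: af.
    + exact: iloss.
    + by apply: integrableBr => //; exact: ifm.
    + move=> A FA; have mA := FT FA.
      rewrite (Rintegral_loss m1 (MPh i) FA).
      rewrite RintegralB ?(is_cond_exp_Rintegral (ifm m (MPh i)) cf FA)//;
        apply: integrableTS => //; exact: ifm.
  apply: filterS (cond_exp_ae (sF _) (@FT _) VE) => x <-.
  exact: bigmin_le.
Qed.

End finite_family.

(** The bound c is the constant value of f_0: E|f_m| = E f_m <= f_0 for every P in M. *)
Let f_bound : exists c, forall m P, M P ->
  P.-integrable setT (EFin \o (fun x => `|f m x|)) /\
  \int[P]_x `|f m x| <= c.
Proof.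
have := @af 0%N; rewrite F0 => /measurable_wrt_trivial[c cE].
exists c => m P MP; have im := ifm m MP.
split; first exact: (integrable_abse im).
have fE : {ae P, forall x, `|f m x| = f m x}.
  by apply: filterS (f0 m MP) => x; exact: ger0_norm.
have mf := integrable_measurable im.
rewrite (ae_Rintegral measurableT _ mf fE); last exact: measurableT_comp.
have FT0 : F 0%N setT by exact: sigma_algebra_setT.
have := supermartingale_Rintegral hF sf MP (ifm 0%N MP) im (leq0n m) FT0.
by rewrite cE Rintegral_cst// [X in fine X](@probability_setT _ _ _ P) mulr1.
Qed.

Lemma expectation_bounded m :
  (ereal_sup [set 'E_P[fun x => (`|f m x|)%R] | P in M] < +oo)%E.
Proof.
have [c cP] := f_bound; apply: (@le_lt_trans _ _ c%:E); last exact: ltry.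
apply: ge_ereal_sup => _ [P MP <-]; have [i1 i2] := cP m P MP.
by rewrite unlock Rintegral_EFin// lee_fin.
Qed.

(** The stopped process takes only the values f_0, ..., f_K, so the sum of their absolute values
    dominates it. *)
Let dominated : exists (phi : T -> R) (t : R),
  [/\ measurable_fun setT phi,
      forall m, as_le M (fun x => `|f (minn m K) x|) phi &
      forall Q, M Q -> ('E_Q[phi] < t%:E)%E].
Proof.
have [c cP] := f_bound.
pose phi n x := \sum_(i < n) `|f i x|.
have phiP n Q : M Q -> Q.-integrable setT (EFin \o phi n) /\
    \int[Q]_x phi n x <= c *+ n.
  move=> MQ; elim: n => [|n [i1 i2]].
    rewrite (_ : phi 0%N = cst 0); last by apply/funext => x; rewrite /phi big_ord0.
    split; first exact: (finite_measure_integrable_cst Q 0).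
    by rewrite Rintegral_cst// mul0r.
  have [j1 j2] := cP n Q MQ.
  rewrite (_ : phi n.+1 = fun x => phi n x + `|f n x|); last first.
    by apply/funext => x; rewrite /phi big_ord_recr.
  split; first exact: integrableDr.
  by rewrite RintegralD// mulrSr lerD.
(* Each of the K+1 terms has expectation at most c; the extra 1 makes the bound strict. *)
exists (phi K.+1), (c *+ K.+1 + 1); split.
- apply: measurable_sum => i; apply: measurableT_comp => //.
  exact: (adapted_measurable i hF af).
- move=> m P MP; apply: aeW => x.
  have mK : (minn m K < K.+1)%N by rewrite ltnS geq_minr.
  by rewrite /phi (bigD1 (Ordinal mK))//= lerDl sumr_ge0.
- move=> Q MQ; have [i1 i2] := phiP K.+1 Q MQ.
  by rewrite unlock Rintegral_EFin// lte_fin (le_lt_trans i2)// ltrDl.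
Qed.

Lemma regular_stopped m : (1 <= m <= K)%N ->
  (forall P, M P -> ~ {ae P, forall x, loss m x = 0}) ->
  regular M F (fun m => f (minn m K)).
Proof.
move=> /andP[m1 mK] lossm; split; [exact: sfK|exact: dominated|].
exists gbar; split => //.
  move=> j P _ MP; rewrite unlock Rintegral_EFin ?ltry//.
  exact: igbar.
move=> s Ph l L MPh _ _; split.
  have [phi [h1 h2 h3 h4]] := one_step_decrease MPh m1 lossm.
  exists m, phi; split => //.
  by rewrite (minn_idPl mK) (minn_idPl (leq_trans (leq_pred m) mK)).
have [C [maxC gC]] := compensator_maximal_chain MPh.
exists C, g; split => //.
- move=> k j i kj _ P MP; apply: (ae_equiv Mequiv (MPh i) MP).
  have [_ _ ce] := compensated_martingale.
  exact: ce.
(* The increment of [g] is [gbar] itself, so the two conditional expectations are of the same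
   function. *)
- move=> [//|j] i _ P MP; apply: aeW => x; congr cond_exp.
  by apply/funext => y; rewrite gS addrAC subrr add0r.
Qed.

End stopped.

Lemma ratio_local_regular : ~ martingale M F f -> local_regular M F f.
Proof.
move=> /loss_not_ae0[m m1 lossm]; split => //.
  exact: expectation_bounded.
(* The stopping times start at m, so that the nonzero loss found above occurs in every stopped
   process. *)
exists (fun n => (m + n)%N); split.
- by move=> i j; exact: leq_add2l.
- exact: cvg_addnl.
- by move=> n; apply: (regular_stopped _ lossm); rewrite m1 leq_addr.
Qed.

End sufficiency.

Theorem theorem4p1 (d : measure_display) (T : measurableType d) (R : realType)
    (F : nat -> set (set T)) (M : set (probability T R)) (f : nat -> T -> R)
    (F_filtration : filtration F)
    (F0_trivial : F 0%N = [set set0; setT])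
    (M_convex : convex_measures M)
    (M_equiv : mutually_equivalent M)
    (f_supermartingale : supermartingale M F f)
    (f_ge0 : forall m, as_le M (cst 0) (f m))
    (f_not_martingale : ~ martingale M F f) :
  local_regular M F f <->
  forall m, (1 <= m)%N ->
    exists xi : T -> R,
      [/\ measurable_wrt (F m) xi,
          A0 M xi,
          as_le M (fun x => f m x / f m.-1 x) xi &
          forall P, M P -> {ae P, forall x, cond_exp P (F m.-1) xi x = 1}].
Proof.
split=> [reg m m1|ratio]; first exact: local_regular_ratio.
(* The bound is given for m >= 1 only; index 0 receives the placeholder 0 so that [choice] yields a
   whole sequence. *)
have xi_ex m : exists xi : T -> R, (1 <= m)%N ->
    [/\ measurable_wrt (F m) xi, A0 M xi,
        as_le M (fun x => f m x / f m.-1 x) xi &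
        forall P, M P -> {ae P, forall x, cond_exp P (F m.-1) xi x = 1}].
  by case: m => [|m]; [exists (cst 0)|have [xi ?] := ratio m.+1 isT; exists xi].
have [xi xiP] := choice xi_ex.
exact: (ratio_local_regular F_filtration F0_trivial M_convex M_equiv
  f_supermartingale f_ge0 xiP).
Qed.
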